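(* Suppose $\mathcal{X}$ is an infinite-dimensional discrete function space on a tree $T$ on which the differentiation operator $D$ (equivalently, the composition operator $C_b$) is bounded. If $\sigma(C_b)$ contains an element other than $1$, then $D$ is not compact on $\mathcal{X}$.
   Context: A tree $T$ is a locally finite, connected, simply-connected graph, identified with its set of vertices. A vertex is terminal if it has a unique neighbor; all trees are assumed to be without terminal vertices (hence infinite) and rooted at a vertex $o$. For $v\neq o$, $v^-$ denotes the unique neighbor of $v$ lying on the path from $o$ to $v$ (the parent of $v$). A function on $T$ is a complex-valued function on its vertices. The backward shift map $b:T\to T$ is $b(v)=v^-$ for $v\neq o$ and $b(o)=o$. The derivative of $f:T\to\mathbb{C}$ is $f'(v)=f(v)-f(b(v))$ for all $v\in T$ (so $f'(o)=0$). A functional Banach space on a set $\Omega$ is a Banach space of complex-valued functions on $\Omega$ with pointwise vector operations, such that $f(x)=g(x)$ for all $x\in\Omega$ implies $f=g$, $f(x)=f(y)$ for every $f$ in the space implies $x=y$, and for each $x\in\Omega$ the linear functional $f\mapsto f(x)$ is continuous. A discrete function space $\mathcal{X}$ on $T$ is a functional Banach space whose elements are functions on $T$, with norm $\|\cdot\|_{\mathcal{X}}$. The differentiation operator is $Df=f'$, and the composition operator induced by $b$ is $C_bf=f\circ b$. An operator is bounded on $\mathcal{X}$ if it is a bounded linear operator from $\mathcal{X}$ to $\mathcal{X}$. $\sigma(C_b)$ is the spectrum of $C_b$ on $\mathcal{X}$. A linear operator $A:\mathcal{X}\to\mathcal{X}$ is compact if for every bounded sequence $\{x_n\}$ in $\mathcal{X}$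 the sequence $\{Ax_n\}$ has a convergent subsequence in $\mathcal{X}$. *)

(* Defs.v *)
From HB Require Import structures.
From mathcomp Require Import all_boot all_order all_algebra.
From mathcomp Require Import all_classical all_reals all_analysis.
From mathcomp Require Import complex.

Set Implicit Arguments.
Unset Strict Implicit.
Unset Printing Implicit Defensive.

Import Order.TTheory GRing.Theory Num.Theory.
Import numFieldNormedType.Exports.

Local Open Scope classical_set_scope.
Local Open Scope ring_scope.

(* [tree_acyclic] expresses simple connectedness: a cycle of a simple graph
   is a closed walk through at least three pairwise distinct vertices.
   [tree_infinite] only excludes the one-vertex graph, whose vertex has no
   neighbor at all and hence is not terminal. *)
Record rooted_tree := RootedTree {
  vertex :> choiceType;
  adj : rel vertex;
  tree_root : vertex;
  adj_sym : symmetric adj;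
  adj_irrefl : irreflexive adj;
  tree_locally_finite : forall v, finite_set [set w | adj v w];
  tree_connected : forall u v, exists2 p, path adj u p & last u p = v;
  tree_acyclic : forall c : seq vertex, (2 < size c)%N -> ~ ucycle adj c;
  tree_no_terminal : forall v, ~ exists! w, adj v w;
  tree_infinite : infinite_set [set: vertex] }.

Arguments adj {r} _ _.
Arguments tree_root {r}.

Definition on_path (T : rooted_tree) (u v w : T) : Prop :=
  exists p : seq T,
    [/\ path adj u p, last u p = v, uniq (u :: p) & w \in u :: p].

(* In a tree the set below is a singleton when [v != tree_root]; the default value
   of [xget] is never used. *)
Definition backward_shift (T : rooted_tree) (v : T) : T :=
  if v == tree_root then tree_root
  else xget tree_root [set w | adj v w /\ on_path tree_root v w].

(* [fbs_space] is the Banach space and [fbs_eval f x] is the value f(x): by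
   [fbs_ext] and [fbs_evalP], [fbs_eval] identifies [fbs_space] with a space of
   functions on [Omega] with the pointwise vector operations.
   [R[i]^o] is [R[i]] with its usual norm topology. *)
Record functional_banach_space (R : realType) (Omega : Type) :=
  FunctionalBanachSpace {
  fbs_space :> completeNormedModType R[i];
  fbs_eval : fbs_space -> Omega -> R[i];
  fbs_evalP : forall (a : R[i]) (f g : fbs_space) (x : Omega),
    fbs_eval (a *: f + g) x = a * fbs_eval f x + fbs_eval g x;
  fbs_ext : forall f g : fbs_space, fbs_eval f =1 fbs_eval g -> f = g;
  fbs_sep : forall x y : Omega,
    (forall f : fbs_space, fbs_eval f x = fbs_eval f y) -> x = y;
  fbs_eval_continuous : forall x : Omega,
    continuous (fun f : fbs_space => fbs_eval f x : R[i]^o) }.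

Definition discrete_function_space (R : realType) (T : rooted_tree) :=
  functional_banach_space R T.

Definition infinite_dimensional (R : realType) (V : normedModType R[i]) :
    Prop :=
  ~ exists (n : nat) (e : 'I_n -> V),
      forall x, exists c : 'I_n -> R[i], x = \sum_(i < n) c i *: e i.

Section Operators.
Context {R : realType} {V : normedModType R[i]}.

Definition bounded_operator (A : V -> V) : Prop :=
  linear A /\ exists M : R[i], forall x, `|A x| <= M * `|x|.

Definition spectrum (A : V -> V) : set R[i] :=
  [set l | ~ exists B : V -> V,
     [/\ bounded_operator B,
         forall x, B (l *: x - A x) = x &
         forall x, l *: B x - A (B x) = x]].

Definition compact_operator (A : V -> V) : Prop :=
  linear A /\
  forall x : nat -> V, bounded_fun x ->
    exists2 phi : nat -> nat, {homo phi : m n / (m < n)%N} &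
      exists y : V, (fun n => A (x (phi n))) @ \oo --> y.

End Operators.

Section FunctionOperators.
Context {R : realType} {Omega : Type}.
Variable X : functional_banach_space R Omega.
Implicit Type F : (Omega -> R[i]) -> Omega -> R[i].

Definition preserves F : Prop :=
  forall f : X, exists g : X, fbs_eval g = F (fbs_eval f).

(* The map f |-> F f as a self-map of [X], meaningful when [preserves F]; the
   element of [X] with values [F (fbs_eval f)] is then unique by [fbs_ext]. *)
Definition operator_on F : X -> X :=
  fun f => xget 0 [set g : X | fbs_eval g = F (fbs_eval f)].

Definition bounded_on F : Prop :=
  preserves F /\ bounded_operator (operator_on F).

End FunctionOperators.

Arguments operator_on {R Omega} X F f.

Definition differentiation (R : realType) (T : rooted_tree)
    (f : T -> R[i]) : T -> R[i] :=
  fun v => f v - f (backward_shift v).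

Definition backward_composition (R : realType) (T : rooted_tree)
    (f : T -> R[i]) : T -> R[i] :=
  f \o @backward_shift T.

Lemma operator_onE (R : realType) (Omega : Type)
    (X : functional_banach_space R Omega) F (f : X) :
  preserves X F -> fbs_eval (operator_on X F f) = F (fbs_eval f).
Proof.
move=> /(_ f)[g Xg]; rewrite /operator_on; case: xgetP => [h _ //|].
by move=> /(_ g).
Qed.

Lemma bounded_on_complement (R : realType) (Omega : Type)
    (X : functional_banach_space R Omega) F G :
  (forall f v, G f v = f v - F f v) -> bounded_on X F -> bounded_on X G.
Proof.
move=> GE [pF [lF [M FM]]].
have evB (f g : X) v : fbs_eval (f - g) v = fbs_eval f v - fbs_eval g v.
  by rewrite -scaleN1r addrC fbs_evalP mulN1r addrC.
have pG : preserves X G.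
  move=> f; exists (f - operator_on X F f).
  by apply/funext => v; rewrite evB operator_onE // GE.
have E f : operator_on X G f = f - operator_on X F f.
  by apply: fbs_ext => v; rewrite operator_onE // evB operator_onE // GE.
split=> //; split=> [a f g|]; first by rewrite !E lF scalerBr opprD addrACA.
exists (1 + M) => f.
by rewrite E (le_trans (ler_normB _ _)) // mulrDl mul1r lerD.
Qed.

Lemma bounded_on_differentiationE (R : realType) (T : rooted_tree)
    (X : discrete_function_space R T) :
  bounded_on X (@differentiation R T) <->
  bounded_on X (@backward_composition R T).
Proof.
split; apply: bounded_on_complement => f v //.
by rewrite /differentiation subKr.
Qed.

(* Main.v *)
From HB Require Import structures.
Require Import Defs.
From mathcomp Require Import all_boot all_order all_algebra.
From mathcomp Require Import all_classical all_reals all_analysis.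
From mathcomp Require Import complex.

(** The composition operator is [C_b = 1 - D], so [l] in the spectrum of [C_b]
    with [l <> 1] gives a nonzero point [1 - l] of the spectrum of [D]
    ([spectrum_complement]). If [D] were compact, the Fredholm alternative
    ([fredholm_alternative]) would make [1 - l] an eigenvalue of [D], that is,
    there would be a nonzero [f] in the space with [f \o b = l f].

    No such function exists on the tree ([backward_shift_eigenfunction0]).
    At the root, which [b] fixes, [f = l f] forces the value [0]. If [l <> 0],
    then [f v = l^-1 f (b v)], and the value [0] propagates from each vertex to
    its children. If [l = 0], then [f] vanishes on the range of [b], which is
    the whole tree because every vertex has a child, there being no terminal
    vertices ([backward_shift_surjective]).

    The Fredholm alternative rests on Riesz's argument. Let [S = mu - K] with
    [K] compact, [mu != 0] and [S] injective. A bounded sequence whose images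
    under [S] converge has a convergent subsequence, since
    [x = mu^-1 (S x + K x)] ([compact_perturbation_proper]). Hence [S] is
    bounded below and sends closed sets to closed sets. If [S] missed a vector,
    the ranges of the iterates of [S] would be a strictly decreasing sequence
    of closed subspaces; unit vectors chosen in each of them at distance at
    least [1/2] from the next would have images under [K] at mutual distances
    at least [`|mu| / 2], against compactness
    ([compact_perturbation_surjective]). *)

Set Implicit Arguments.
Unset Strict Implicit.
Unset Printing Implicit Defensive.
Import Order.TTheory GRing.Theory Num.Theory.
Import numFieldNormedType.Exports.
Local Open Scope classical_set_scope.
Local Open Scope ring_scope.

(** * Simple paths and the backward shift *)

Section Tree.
Context {T : rooted_tree}.
Implicit Types (u v w x y : T) (p q : seq T).
Local Notation o := (@tree_root T).

(** Otherwise a simple path extracted from [p], closed up through [v], is a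
    cycle. All uses of acyclicity go through this lemma. *)
Lemma neighbors_joined_off_vertex v u w p :
  adj v u -> adj v w -> path adj u p -> last u p = w -> v \notin u :: p ->
  u = w.
Proof.
move=> vu vw pathp lastp; rewrite -lastp in vw *; case: (shortenP pathp) vw.
move=> {pathp} [//|y q] pathq uniqq sub lastq vNp; exfalso.
apply: (@tree_acyclic T [:: v, u, y & q]) => //.
have vNq : v \notin [:: u, y & q].
  move: vNp; rewrite !(inE, negb_or) => /andP[-> vp] /=.
  by rewrite -negb_or -in_cons; apply: contra vp => /sub.
apply/andP; split; last by rewrite cons_uniq vNq.
rewrite /cycle rcons_path; apply/andP; split; last by rewrite adj_sym.
exact/andP.
Qed.

Lemma neighbor_on_simple_path x p v u :
  path adj x (rcons p v) -> uniq (x :: rcons p v) -> u \in x :: p ->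
  adj v u -> u = last x p.
Proof.
rewrite rcons_path -rcons_cons rcons_uniq.
move=> /andP[pathp lastv] /andP[vNp _] up vu.
case/splitPl: up pathp lastv vNp => p1 p2 lastp1; subst u.
rewrite cat_path last_cat => /andP[_ path2] lastv vNp.
apply: (neighbors_joined_off_vertex vu _ path2) => //; first by rewrite adj_sym.
apply: contra vNp; rewrite -cat_cons mem_cat inE => /orP[/eqP->|->].
  by rewrite mem_last.
by rewrite orbT.
Qed.

(** Two different last steps, from [w1] to [v] and from [w2] to [v], are
    impossible: going back along one path from [w1] to [x] and then along the
    other to [w2] joins two neighbors of [v] without meeting [v]. *)
Lemma simple_path_unique x p q :
  path adj x p -> path adj x q -> uniq (x :: p) -> uniq (x :: q) ->
  last x p = last x q -> p = q.
Proof.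
elim/last_ind: p q => [|p v IH] q; case/lastP: q => [|q w] //.
- by rewrite last_rcons /= rcons_uniq mem_rcons inE => _ _ _ + e; rewrite e eqxx.
- by rewrite last_rcons /= rcons_uniq mem_rcons inE => _ _ + _ e; rewrite e eqxx.
rewrite !last_rcons => pp pq up uq vw; subst w.
congr rcons; move: (pp) (pq) (up) (uq).
rewrite !rcons_path -!rcons_cons !rcons_uniq.
move=> /andP[pathp pv] /andP[pathq qv] /andP[vNp uniqp] /andP[vNq uniqq].
apply: IH => //; rewrite adj_sym in pv; rewrite adj_sym in qv.
apply: (neighbors_joined_off_vertex (p := rev (belast x p) ++ q) pv qv).
- rewrite cat_path (@rev_path _ _ x) (eq_path (e' := adj)) ?pathp.
    by case: (p) pathq {pathp} => [|a p'] //=; rewrite rev_cons last_rcons.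
  by move=> a b; rewrite adj_sym.
- by rewrite last_cat; case: (p) => [|a p'] //=; rewrite rev_cons last_rcons.
rewrite -cat_cons mem_cat negb_or; apply/andP; split.
  by rewrite -rev_rcons -lastI mem_rev.
by move: vNq; rewrite inE negb_or => /andP[].
Qed.

Lemma simple_path_from_root v :
  exists p, [/\ path adj o p, last o p = v & uniq (o :: p)].
Proof.
have [p pathp <-] := tree_connected o v.
by case: (shortenP pathp) => q pathq uniqq _; exists q.
Qed.

Lemma backward_shift_last p v :
  path adj o (rcons p v) -> uniq (o :: rcons p v) ->
  backward_shift v = last o p.
Proof.
move=> pathp uniqp; rewrite /backward_shift.
have -> : (v == o) = false.
  apply/negbTE; move: uniqp; rewrite cons_uniq mem_rcons inE negb_or eq_sym.
  by case/andP => /andP[].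
case: xgetP => [u _ [vu]|/(_ (last o p)) []].
  move=> [q [pathq lastq uniqq uq]].
  have Eq : q = rcons p v.
    by apply: (simple_path_unique pathq pathp); rewrite ?last_rcons.
  move: uq; rewrite Eq -rcons_cons mem_rcons inE => /orP[/eqP uv|up].
    by rewrite uv adj_irrefl in vu.
  exact: (neighbor_on_simple_path pathp uniqp up vu).
split; first by move: pathp; rewrite rcons_path adj_sym => /andP[].
exists (rcons p v); split; rewrite ?last_rcons //.
by rewrite -rcons_cons mem_rcons inE mem_last orbT.
Qed.

(** A neighbor of [v] off the simple path from the root to [v] is a child of
    [v]. It exists because only one neighbor of [v] lies on that path, while
    [v] has at least two neighbors, or [v] is the root and has at least one. *)
Lemma backward_shift_surjective v : exists w, backward_shift w = v.
Proof.
have [p [pathp lastp uniqp]] := simple_path_from_root v.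
suff [w vw wNp] : exists2 w, adj v w & w \notin o :: p.
  exists w; rewrite (@backward_shift_last p) ?rcons_path ?pathp ?lastp //.
  by rewrite -rcons_cons rcons_uniq wNp.
case/lastP: p => [|p w] in pathp lastp uniqp *.
  have /infinite_setN0[y [_ yv]] : infinite_set ([set: T] `\ v).
    apply: infinite_setD (finite_set1 v); exact: tree_infinite.
  have [q] := tree_connected v y.
  case: q => [_ /= vy|w q /= /andP[vw _] _]; first by case: yv.
  exists w => //; rewrite inE; apply/eqP => wo.
  by move: vw; rewrite -lastp /= wo adj_irrefl.
rewrite last_rcons in lastp; subst w.
have vl : adj v (last o p).
  by move: pathp; rewrite rcons_path adj_sym => /andP[].
apply: contrapT => noext; apply: (@tree_no_terminal T v).
exists (last o p); split=> // w vw; apply/esym.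
apply: (neighbor_on_simple_path pathp uniqp) => //.
apply: contrapT => /negP wNp; apply: noext; exists w => //.
rewrite -rcons_cons mem_rcons inE negb_or wNp andbT.
by apply: contraTneq vw => ->; rewrite adj_irrefl.
Qed.

Lemma backward_shift_eigenfunction0 (R : realType) (l : R[i]) (f : T -> R[i]) :
  l <> 1 -> (forall v, f (backward_shift v) = l * f v) -> forall v, f v = 0.
Proof.
move=> l1 fb.
have [l0|l0] := eqVneq l 0.
  move=> v; have [w <-] := backward_shift_surjective v.
  by rewrite fb l0 mul0r.
have fo : f o = 0.
  have := fb o; rewrite /backward_shift eqxx => fo.
  apply/eqP; apply: contrapT => /negP fo0; apply: l1.
  by apply: (mulIf fo0); rewrite mul1r -fo.
move=> v; have [p [pathp <- uniqp]] := simple_path_from_root v.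
elim/last_ind: p pathp uniqp => [//|p w IH] pathp uniqp.
rewrite last_rcons; apply: (mulfI l0).
rewrite -fb (backward_shift_last pathp uniqp) mulr0 IH //.
  by move: pathp; rewrite rcons_path => /andP[].
by move: uniqp; rewrite -rcons_cons rcons_uniq => /andP[].
Qed.

End Tree.

(** * Sequences and operators in complex normed spaces *)

Lemma complex_archimedean (R : realType) (x : R[i]) :
  0 <= x -> exists n : nat, x < n%:R.
Proof.
move=> x0; exists (Num.bound (complex.Re x)).
rewrite -(RRe_real (ger0_real x0)) -(rmorph_nat (real_complex R)) ltcR /=.
by rewrite archi_boundP // -lecR RRe_real ?ger0_real.
Qed.

Lemma homo_ltn_ge_id (phi : nat -> nat) :
  {homo phi : m n / (m < n)%N} -> forall n, (n <= phi n)%N.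
Proof. by move=> phiS; elim=> // n /leq_ltn_trans; apply; exact: phiS. Qed.

Section NormedSpace.
Context {R : realType} {V : normedModType R[i]}.
Implicit Types (x y z u w : V) (W : set V) (A K : V -> V).

Lemma cvg_dist_invn (u : nat -> V) y :
  (forall n, `|y - u n| < n.+1%:R^-1) -> u @ \oo --> y.
Proof.
move=> uy; apply/cvgrPdist_lt => e e0.
have [N eN] : exists n : nat, e^-1 < n%:R.
  by apply: complex_archimedean; rewrite invr_ge0 ltW.
exists N => // n /= Nn; apply: (lt_trans (uy n)).
rewrite -(invrK e) ltf_pV2 ?posrE ?invr_gt0 ?ltr0Sn //.
by apply: (lt_le_trans eN); rewrite ler_nat leqW.
Qed.

Lemma cvg_subseq (u : nat -> V) (phi : nat -> nat) y :
  {homo phi : m n / (m < n)%N} -> u @ \oo --> y ->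
  (fun n => u (phi n)) @ \oo --> y.
Proof.
move=> phiS uy; apply: cvg_comp uy => P [N _ NP].
exists N => // n /= Nn; apply: NP => /=.
exact: leq_trans Nn (homo_ltn_ge_id phiS n).
Qed.

Lemma bounded_fun_le (u : nat -> V) (M : R[i]) :
  (forall n, `|u n| <= M) -> bounded_fun u.
Proof.
move=> uM; have FF : ProperFilter (globally [set: nat]).
  exact: (@globally_properfilter _ _ 0%N).
by rewrite /= ex_bound; exists M => n _; exact: uM. Qed.

Lemma bounded_operator_gt0 A :
  bounded_operator A -> exists2 M : R[i], 0 < M & forall x, `|A x| <= M * `|x|.
Proof.
move=> [_ [M AM]]; exists (`|M| + 1) => [|x]; first by rewrite ltr_wpDl.
rewrite mulrDl mul1r ler_wpDr //.
have := AM x; rewrite -(ger0_norm (le_trans (normr_ge0 _) (AM x))).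
by rewrite normrM normr_id.
Qed.

Lemma linear_sub A : linear A -> forall x y, A (x - y) = A x - A y.
Proof. by move=> lA x y; rewrite addrC -scaleN1r lA scaleN1r addrC. Qed.

Lemma linear_scale A : linear A -> forall a x, A (a *: x) = a *: A x.
Proof.
move=> lA a x; have A0 : A 0 = 0 by have := linear_sub lA 0 0; rewrite !subrr.
by rewrite -[a *: x]addr0 lA A0 addr0.
Qed.

Lemma cvg_bounded_operator A (u : nat -> V) x :
  bounded_operator A -> u @ \oo --> x -> (fun n => A (u n)) @ \oo --> A x.
Proof.
move=> bA; have [M M0 AM] := bounded_operator_gt0 bA; have linA := bA.1.
move/cvgrPdist_lt => ux; apply/cvgrPdist_lt => e e0.
have := ux (e / M); rewrite divr_gt0 // => /(_ isT).
apply: filterS => n; rewrite ltr_pdivlMr // mulrC -linear_sub //.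
exact: le_lt_trans.
Qed.

(** * The Riesz lemma *)

(** Linear subspaces as classical sets, the form in which ranges of operators
    and topological closedness are available. *)
Definition is_subspace W :=
  W !=set0 /\ forall (a : R[i]) x y, W x -> W y -> W (a *: x + y).

Lemma subspace0 W : is_subspace W -> W 0.
Proof. by move=> [[x Wx] WD]; rewrite -(addNr x) -scaleN1r; exact: WD. Qed.

Lemma subspace_scale W a x : is_subspace W -> W x -> W (a *: x).
Proof.
by move=> sW Wx; rewrite -[_ *: _]addr0; apply: sW.2 => //; exact: subspace0.
Qed.

Lemma subspace_add W x y : is_subspace W -> W x -> W y -> W (x + y).
Proof. by move=> sW Wx Wy; rewrite -[x]scale1r; exact: sW.2. Qed.

Lemma subspace_sub W x y : is_subspace W -> W x -> W y -> W (x - y).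
Proof. by move=> sW Wx Wy; rewrite addrC -scaleN1r; exact: sW.2. Qed.

Lemma subspace_image A W : linear A -> is_subspace W -> is_subspace (A @` W).
Proof.
move=> linA [[z Wz] WD]; split; first by exists (A z); exists z.
move=> a _ _ [x Wx <-] [y Wy <-]; exists (a *: x + y); last exact: linA.
exact: WD.
Qed.

(** The distance from [z] to a closed set avoiding [z] is positive, hence is
    less than twice itself and some [w] does better than that. The norm takes
    its values in [R[i]]; the infimum is taken over real parts, in [R]. *)
Lemma near_best_approximation W z : closed W -> W !=set0 -> ~ W z ->
  exists2 w, W w & forall u, W u -> `|z - w| <= 2 * `|z - u|.
Proof.
move=> clW [w0 Ww0] Wz.
pose D := [set complex.Re `|z - w| | w in W].
have normE w : (complex.Re `|z - w|)%:C%C = `|z - w|.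
  by rewrite RRe_real ?normr_real.
have D0 : lbound D 0.
  by move=> _ [w _ <-]; rewrite -lecR normE; exact: normr_ge0.
have infD : has_inf D.
  split; first by exists (complex.Re `|z - w0|), w0.
  by exists 0.
have inf_le w : W w -> (inf D)%:C%C <= `|z - w|.
  move=> Ww; rewrite -normE lecR.
  by apply: ge_inf => //; [exact: infD.2|exists w].
have inf0 : 0 < inf D.
  rewrite lt_neqAle; apply/andP; split; last first.
    exact: lb_le_inf infD.1 D0.
  apply/eqP => inf0; apply: Wz; apply: clW => B /nbhs_ballP[e /= e0 eB].
  have Re0 : 0 < complex.Re e by rewrite -ltcR RRe_real ?gtr0_real.
  have [_ [w Ww <-]] := inf_adherent Re0 infD.
  rewrite -inf0 add0r -ltcR normE RRe_real ?gtr0_real // => wlt.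
  by exists w; split=> //; apply: eB; rewrite -ball_normE.
have [_ [w Ww <-] wlt] := inf_adherent inf0 infD.
exists w => // u Wu; apply: le_trans (_ : 2 * (inf D)%:C%C <= _); last first.
  by rewrite ler_pM2l //; exact: inf_le.
by rewrite -normE mulr_natl mulr2n -rmorphD lecR ltW.
Qed.

(** Normalize the difference of [z] and a near-best approximation [w] of [z]
    in [W]: translating by [w] and scaling preserve [W], so the distance of
    [z - w] to [W] is still at least half its norm. *)
Lemma riesz_almost_orthogonal Z W z :
    is_subspace Z -> is_subspace W -> closed W -> W `<=` Z -> Z z -> ~ W z ->
  exists x, [/\ Z x, `|x| = 1 & forall u, W u -> 2^-1 <= `|x - u|].
Proof.
move=> sZ sW clW WZ Zz Wz.
have [w Ww wP] := near_best_approximation clW sW.1 Wz.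
have zw0 : 0 < `|z - w|.
  by rewrite normr_gt0 subr_eq0; apply/eqP => zw; apply: Wz; rewrite zw.
exists (`|z - w|^-1 *: (z - w)); split.
- by apply: subspace_scale => //; apply: subspace_sub => //; exact: WZ.
- by rewrite normrZ normfV normr_id mulVf // gt_eqF.
move=> u Wu.
have -> : `|z - w|^-1 *: (z - w) - u =
    `|z - w|^-1 *: (z - (w + `|z - w| *: u)).
  by rewrite opprD addrA [RHS]scalerBr scalerA mulVf ?scale1r // gt_eqF.
rewrite normrZ normfV normr_id mulrC ler_pdivlMr // mulrC ler_pdivrMr // mulrC.
by apply: wP; apply: subspace_add => //; exact: subspace_scale.
Qed.

(** * Compact perturbations of nonzero scalar operators *)

Section CompactPerturbation.
Variables (K : V -> V) (mu : R[i]).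
Hypotheses (mu0 : mu != 0) (bK : bounded_operator K) (cK : compact_operator K).
Let S x := mu *: x - K x.

Lemma compact_perturbation_linear : linear S.
Proof.
move=> a x y; rewrite /S bK.1 scalerDr scalerBr !scalerA [mu * a]mulrC opprD.
by rewrite addrACA.
Qed.

(** Along a subsequence with [K x] convergent, [x = mu^-1 (S x + K x)]
    converges as well, and continuity of [K] identifies the image of the limit.
    This is the only consequence of compactness used below, apart from the
    last step of surjectivity. *)
Lemma compact_perturbation_proper (x : nat -> V) y :
  bounded_fun x -> (fun n => S (x n)) @ \oo --> y ->
  exists2 phi : nat -> nat, {homo phi : m n / (m < n)%N} &
    exists2 z, (fun n => x (phi n)) @ \oo --> z & S z = y.
Proof.
move=> bx Sxy; have [phi phiS [k Kxk]] := cK.2 x bx; exists phi => //.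
have Sphi := cvg_subseq phiS Sxy.
have xz : (fun n => x (phi n)) @ \oo --> mu^-1 *: (y + k).
  have -> : (fun n => x (phi n)) =
      (fun n => mu^-1 *: (S (x (phi n)) + K (x (phi n)))).
    by apply/funext => n; rewrite subrK scalerA mulVf // scale1r.
  by apply: cvgZl_tmp; apply: cvgD.
exists (mu^-1 *: (y + k)) => //.
have Kk : K (mu^-1 *: (y + k)) = k.
  exact: (cvg_unique (@norm_hausdorff _ V) (cvg_bounded_operator bK xz) Kxk).
by rewrite /S Kk scalerA mulfV // scale1r addrK.
Qed.

Hypothesis injS : forall x, S x = 0 -> x = 0.

(** If no constant works, there are unit vectors whose images under [S] tend to
    [0]; a limit point of them is a unit vector in the kernel. *)
Lemma compact_perturbation_bounded_below :
  exists2 c : R[i], 0 < c & forall x, `|x| <= c * `|S x|.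
Proof.
apply: contrapT => noc.
have /choice[x xP] : forall n : nat, exists x, `|x| = 1 /\ `|S x| < n.+1%:R^-1.
  move=> n; apply: contrapT => nox; apply: noc.
  exists n.+1%:R; rewrite ?ltr0Sn // => x.
  have Sx0 : 0 <= n.+1%:R * `|S x| by rewrite mulr_ge0.
  rewrite real_leNgt ?normr_real ?ger0_real //; apply/negP => xlt.
  have x0 : 0 < `|x| by exact: le_lt_trans Sx0 xlt.
  apply: nox; exists (`|x|^-1 *: x); split.
    by rewrite normrZ normfV normr_id mulVf // gt_eqF.
  rewrite (linear_scale compact_perturbation_linear) normrZ normfV normr_id.
  by rewrite mulrC ltr_pdivrMr // mulrC ltr_pdivlMr ?ltr0Sn // mulrC.
have [||phi _ [z xz Sz]] := @compact_perturbation_proper x 0.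
- by apply: (bounded_fun_le (M := 1)) => n; rewrite (xP n).1.
- by apply: cvg_dist_invn => n; rewrite sub0r normrN (xP n).2.
have z1 : `|z| = 1.
  apply: (cvg_unique (@norm_hausdorff _ (R[i]^o)) (cvg_norm xz)).
  rewrite (_ : (fun n => _) = cst 1); first exact: cvg_cst.
  by apply/funext => n; rewrite (xP _).1.
by move: z1; rewrite (injS Sz) normr0 => /esym/eqP; rewrite oner_eq0.
Qed.

(** Preimages of a convergent sequence of [S @` W] are bounded because [S] is
    bounded below, so that a subsequence of them converges, in [W]. *)
Lemma compact_perturbation_closed_image W : closed W -> closed (S @` W).
Proof.
move=> clW y cly; have [c c0 cS] := compact_perturbation_bounded_below.
have /choice[x xP] : forall n : nat, exists x, W x /\ `|y - S x| < n.+1%:R^-1.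
  move=> n; have := cly (ball y n.+1%:R^-1).
  case; first by apply: nbhsx_ballx; rewrite invr_gt0 ltr0Sn.
  by move=> _ [[x Wx <-]]; rewrite -ball_normE /= => yx; exists x.
have [||phi phiS [z xz <-]] := @compact_perturbation_proper x y.
- apply: (bounded_fun_le (M := c * (`|y| + 1))) => n.
  apply: (le_trans (cS _)); rewrite ler_pM2l //.
  rewrite -[S _](subKr y) (le_trans (ler_normB _ _)) // lerD2l ltW //.
  by apply: lt_le_trans (xP n).2 _; rewrite invf_le1 ?ltr0Sn // ler1n.
- by apply: cvg_dist_invn => n; exact: (xP n).2.
exists z => //; apply: (closed_cvg W clW _ _ xz).
by exists 0%N => // n _; exact: (xP _).1.
Qed.

(** The ranges [W n] of the iterates of [S] decrease, and if [S] misses [y]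
    then, by injectivity, [W n.+1] misses the [n]-th iterate of [S] at [y].
    Unit vectors [x n] of [W n] at distance at least [1/2] from [W n.+1] have
    images under [K] that stay away from one another. *)
Lemma compact_perturbation_surjective y : exists x, S x = y.
Proof.
apply: contrapT => noy; have linS := compact_perturbation_linear.
have Sinj : injective S.
  by move=> a b Sab; apply/subr0_eq/injS; rewrite linear_sub // Sab subrr.
pose W n := iter n (fun U => S @` U) setT.
have subW (n : nat) : is_subspace (W n).
  elim: n => [|n]; last exact: subspace_image.
  by split; first by exists 0.
have closedW (n : nat) : closed (W n).
  by elim: n => [|n]; [exact: closedT|exact: compact_perturbation_closed_image].
have WS (n : nat) : W n.+1 `<=` W n.
  elim: n => [//|n IH]; exact: image_subset IH.
have decW m n : (m <= n)%N -> W n `<=` W m.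
  elim: n => [|n IH]; first by case: m.
  by rewrite leq_eqVlt => /orP[/eqP->//|/IH]; exact: subset_trans.
have Wproper (n : nat) : exists2 z, W n z & ~ W n.+1 z.
  exists (iter n S y); elim: n => [//|n IH] /=.
  - by exists (iter n S y).
  - by case=> x _ Sxy; apply: noy; exists x.
  - by case=> x Wx /Sinj Ex; apply: IH; rewrite -Ex.
have /choice[x xP] (n : nat) :
    exists x, [/\ W n x, `|x| = 1 & forall u, W n.+1 u -> 2^-1 <= `|x - u|].
  by have [z] := Wproper n; exact: riesz_almost_orthogonal.
have bx : bounded_fun x.
  by apply: (bounded_fun_le (M := 1)) => n; have [_ ->] := xP n.
have [phi phiS [k Kxk]] := cK.2 x bx.
have far m n : (m < n)%N -> `|mu| / 2 <= `|K (x m) - K (x n)|.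
  move=> mn; have [Wm _ +] := xP m; have [Wn _ _] := xP n.
  (* [K (x m) - K (x n)] is [mu] times [x m] minus this vector of [W m.+1];
     the term in [x n] is [K (x n)]. *)
  move/(_ (mu^-1 *: (S (x m) + (mu *: x n - S (x n))))).
  have Wxn : W m.+1 (x n) by exact: decW Wn.
  have WSn : W m.+1 (S (x n)) by apply: WS; exists (x n).
  have WSm : W m.+1 (S (x m)) by exists (x m).
  have -> : K (x m) - K (x n) =
     mu *: (x m - mu^-1 *: (S (x m) + (mu *: x n - S (x n)))).
    rewrite scalerBr scalerA mulfV // scale1r /S.
    by rewrite [mu *: x n - _]subKr opprD addrA subKr.
  rewrite normrZ ler_pM2l ?normr_gt0 // => far; apply: far.
  apply: subspace_scale => //; apply: subspace_add => //.
  by apply: subspace_sub => //; exact: subspace_scale.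
have mu2 : 0 < `|mu| / 2 / 2 by rewrite !divr_gt0 ?normr_gt0.
have [N _ NK] := (cvgrPdist_lt _ _).1 Kxk _ mu2.
suff near : `|K (x (phi N)) - K (x (phi N.+1))| < `|mu| / 2.
  by have := far _ _ (phiS _ _ (ltnSn N)); rewrite (lt_geF near).
rewrite -(subrK k (K (x (phi N)))) -addrA.
rewrite (le_lt_trans (ler_normD _ _)) // [ltRHS]splitr.
by rewrite ltrD //; [rewrite distrC|]; apply: NK => /=.
Qed.

End CompactPerturbation.

Theorem fredholm_alternative K (mu : R[i]) :
  mu != 0 -> bounded_operator K -> compact_operator K ->
  (forall x, K x = mu *: x -> x = 0) -> ~ spectrum K mu.
Proof.
move=> mu0 bK cK eigen; apply; pose S x := mu *: x - K x.
have injS x : S x = 0 -> x = 0.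
  by move=> /subr0_eq/esym; exact: eigen.
have linS : linear S by exact: compact_perturbation_linear.
have [c _ cS] : exists2 c : R[i], 0 < c & forall x, `|x| <= c * `|S x|.
  exact: compact_perturbation_bounded_below.
have /choice[B SB] : forall y, exists x, S x = y.
  exact: compact_perturbation_surjective.
have BS x : B (S x) = x.
  by apply/subr0_eq/injS; rewrite (linear_sub linS) SB subrr.
exists B; split=> //; split; last first.
  by exists c => x; have := cS (B x); rewrite SB.
by move=> a x y; rewrite -{1}(SB x) -{1}(SB y) -linS BS.
Qed.

(** The resolvent of [A] at [l] is the resolvent of [K] at [1 - l] composed
    with negation, because [l - A = - ((1 - l) - K)]. *)
Lemma spectrum_complement A K (l : R[i]) :
  (forall x, A x = x - K x) -> spectrum A l -> spectrum K (1 - l).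
Proof.
move=> AE specA [B [[linB [M BM]] BK KB]]; apply: specA.
have resE x : l *: x - A x = - ((1 - l) *: x - K x).
  by rewrite AE scalerBl scale1r !opprB [RHS]addrCA.
exists (fun x => B (- x)); split.
- split=> [a x y|]; first by rewrite opprD -scalerN linB.
  by exists M => x; rewrite -[`|x|]normrN.
- by move=> x; rewrite resE opprK BK.
- by move=> x; rewrite resE KB opprK.
Qed.

End NormedSpace.

(** * Noncompactness of differentiation *)

Theorem corollary2p21 (R : realType) (T : rooted_tree)
    (X : discrete_function_space R T)
    (X_infdim : infinite_dimensional X)
    (D_bounded : bounded_on X (@differentiation R T))
    (spectrum_Cb : exists2 l : R[i],
       spectrum (operator_on X (@backward_composition R T)) l & l <> 1) :
  ~ compact_operator (operator_on X (@differentiation R T)).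
Proof.
move=> cptD; have [l specC l1] := spectrum_Cb; have [preD bD] := D_bounded.
have [preC _] := (bounded_on_differentiationE X).1 D_bounded.
have evD f v : fbs_eval (operator_on X (@differentiation R T) f) v =
    fbs_eval f v - fbs_eval f (backward_shift v) by rewrite operator_onE.
have evC f v : fbs_eval (operator_on X (@backward_composition R T) f) v =
    fbs_eval f (backward_shift v) by rewrite operator_onE.
have ev0 v : fbs_eval (0 : X) v = 0.
  by have := fbs_evalP (-1) (0 : X) 0 v; rewrite scaleN1r addNr mulN1r addNr.
have evZ a (f : X) v : fbs_eval (a *: f) v = a * fbs_eval f v.
  by rewrite -[a *: f]addr0 fbs_evalP ev0 addr0.
apply: (@fredholm_alternative _ _ _ (1 - l) _ bD cptD).
- by rewrite subr_eq0; apply/eqP => l1'; apply: l1.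
- move=> f Df; apply: fbs_ext => v; rewrite ev0.
  apply: backward_shift_eigenfunction0 l1 _ v => v.
  have := evD f v; rewrite Df evZ mulrBl mul1r.
  by move/addrI/oppr_inj.
- apply: spectrum_complement specC => f; apply: fbs_ext => v.
  by rewrite addrC -scaleN1r fbs_evalP evD evC mulN1r opprB subrK.
Qed.
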